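(* Let $n\in\mathbb N$ and let $f(z)=\sum_{m\ge 0} f_m z^m$ and $h(z)=\sum_{m\ge0}h_mz^m$ be analytic in a neighbourhood of $z=0$, with $f_m=0$ whenever $h_m=0$. Put $s_m=0$ if $f_m=0$ and $s_m=f_m/h_m$ if $f_m\neq 0$. Suppose that the generating polynomial $G_n$ constructed from $s_0,\dots,s_{2n-1}$ has degree exactly $n$ and all its roots are pairwise distinct. Then the amplitude and frequency operator $H_n(z)=\sum_{k=1}^n\mu_k h(\lambda_k z)$ is uniquely determined by the system $$\sum_{k=1}^n\mu_k\lambda_k^m=s_m,\qquad m=0,1,\dots,2n-1,$$ (that is, this system has a solution $\{\mu_k\},\{\lambda_k\}\subset\mathbb C$, unique up to a simultaneous permutation of the indices), and it realizes the $2n$-multiple interpolation of $f$ at $z=0$: $$f(z)=\sum_{k=1}^n\mu_k h(\lambda_k z)+O(z^{2n}),\qquad z\to0.$$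
   Context: Convention: $0^0=1$. For complex numbers $s_0,\dots,s_{2n-1}$ the generating polynomial is the $(n+1)\times(n+1)$ determinant $$G_n(\lambda)=\begin{vmatrix}1&\lambda&\lambda^2&\dots&\lambda^n\\ s_0&s_1&s_2&\dots&s_n\\ s_1&s_2&s_3&\dots&s_{n+1}\\ \vdots&&&&\vdots\\ s_{n-1}&s_n&s_{n+1}&\dots&s_{2n-1}\end{vmatrix}.$$ *)

(* Defs.v *)
(* The complex numbers are R[i] for an arbitrary R : realType. *)
From HB Require Import structures.
From mathcomp Require Import all_boot all_order all_algebra all_fingroup.
From mathcomp Require Import all_classical all_reals all_analysis.
From mathcomp Require Import complex.

Set Implicit Arguments.
Unset Strict Implicit.
Unset Printing Implicit Defensive.

Import Order.TTheory GRing.Theory Num.Theory.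
Import numFieldNormedType.Exports.

Local Open Scope ring_scope.
Local Open Scope complex_scope.
Local Open Scope classical_set_scope.

(* R[i] carries no topology by default; give it the one of its modulus. *)
HB.instance Definition _ (R : rcfType) := NormedModule.copy R[i] R[i]^o.

(* [pseries] is only available over a realType, hence the explicit series. *)
Definition analytic_at0 (R : realType) (f : R[i] -> R[i]) (a : nat -> R[i]) :=
  \forall z \near (0 : R[i]), [series a m * z ^+ m]_m @ \oo --> f z.

(* Row i.+1 is (s_i, s_(i+1), ..., s_(i+n)); only s_0, ..., s_(2n-1) occur. *)
Definition generating_poly (R : realType) (n : nat) (s : nat -> R[i])
    : {poly R[i]} :=
  \det (\matrix_(i < n.+1, j < n.+1)
          if i == 0%N :> nat then 'X^j else (s (i.-1 + j)%N)%:P).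

(* The sequence rs lists the roots of p with multiplicity. *)
Definition distinct_roots (R : realType) (p : {poly R[i]}) :=
  exists2 rs : seq R[i],
    p = lead_coef p *: \prod_(r <- rs) ('X - r%:P) & uniq rs.

Definition coef_ratio (R : realType) (a b : nat -> R[i]) (m : nat) : R[i] :=
  if a m == 0 then 0 else a m / b m.

(* Since x ^+ 0 = 1 for all x, the convention 0^0 = 1 is built in. *)
Definition moment_solution (R : realType) (n : nat) (s : nat -> R[i])
    (mu lam : 'I_n -> R[i]) :=
  forall m : nat, (m < 2 * n)%N -> \sum_(k < n) mu k * lam k ^+ m = s m.

Definition amp_freq_op (R : realType) (n : nat) (mu lam : 'I_n -> R[i])
    (h : R[i] -> R[i]) (z : R[i]) : R[i] :=
  \sum_(k < n) mu k * h (lam k * z).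

(* Main.v *)
(* Let L be the linear functional on polynomials with L(X^m) = s_m, m < 2n.
   Expanding G_n along its first row shows L(X^i G_n) = 0 for i < n, that is,
   s satisfies a linear recurrence with characteristic polynomial G_n, and the
   leading coefficient of G_n is, up to sign, the Hankel determinant
   det(s_(i+j)).

   Existence: take the lambda_k to be the roots of G_n and solve a Vandermonde
   system for the first n moments; the recurrence propagates the others.

   Uniqueness: a solution factors the invertible Hankel matrix as A B with
   A_ik = mu_k lambda_k^i and B_kj = lambda_k^j, so A and B are invertible.
   Invertibility of B makes the lambda_k distinct; the orthogonality relations
   read A (G_n(lambda_k))_k = 0, so the lambda_k are the roots of G_n.

   Interpolation: f - H_n is the sum of a power series whose first 2n
   coefficients vanish. *)
Require Import Defs.
From mathcomp Require Import all_boot all_order all_algebra all_fingroup.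
From mathcomp Require Import all_classical all_reals all_analysis.
From mathcomp Require Import complex.
From mathcomp Require Import ring zify.

Set Implicit Arguments.
Unset Strict Implicit.
Unset Printing Implicit Defensive.

Import Order.TTheory GRing.Theory Num.Theory.
Import numFieldNormedType.Exports.

Local Open Scope ring_scope.
Local Open Scope complex_scope.
Local Open Scope classical_set_scope.

(** * Leading coefficients and Vandermonde systems *)

Lemma coef_pred_size_neq0 (R : nzRingType) (p : {poly R}) (n : nat) :
  size p = n.+1 -> p`_n != 0.
Proof.
move=> szp; have -> : n = (size p).-1 by rewrite szp.
by rewrite -lead_coefE lead_coef_eq0 -size_poly_eq0 szp.
Qed.

Lemma Vandermonde_unit (F : fieldType) (n : nat) (x : 'I_n -> F) :
  injective x -> Vandermonde n (\row_k x k) \in unitmx.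
Proof.
move=> x_inj; rewrite unitmxE det_Vandermonde unitfE.
apply/prodf_neq0 => i _; apply/prodf_neq0 => j lt_ij; rewrite !mxE subr_eq0.
by rewrite (inj_eq x_inj) -val_eqE /= gtn_eqF.
Qed.

(** The moments are the image of the weights under a Vandermonde matrix, invertible for distinct
    nodes. *)
Lemma moments_injective (F : fieldType) (n : nat) (x c d : 'I_n -> F) :
    injective x ->
    (forall m, (m < n)%N ->
       \sum_k c k * x k ^+ m = \sum_k d k * x k ^+ m) ->
  c =1 d.
Proof.
move=> /Vandermonde_unit Vu cd k.
suff: \col_j c j = \col_j d j by move=> /matrixP/(_ k 0); rewrite !mxE.
rewrite -[LHS](mulKmx Vu) -[RHS](mulKmx Vu); congr (_ *m _).
apply/matrixP => i j; rewrite !mxE.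
under eq_bigr do rewrite !mxE mulrC.
by rewrite cd //; apply: eq_bigr => l _; rewrite !mxE mulrC.
Qed.

Lemma moments_surjective (F : fieldType) (n : nat) (x : 'I_n -> F)
    (s : nat -> F) : injective x ->
  exists c : 'I_n -> F,
    forall m, (m < n)%N -> \sum_k c k * x k ^+ m = s m.
Proof.
move=> /Vandermonde_unit Vu.
exists (fun k => (invmx (Vandermonde n (\row_k x k)) *m \col_i s i) k 0).
move=> m lt_mn; have := mulKVmx Vu (\col_i s i).
move=> /matrixP/(_ (Ordinal lt_mn) 0); rewrite !mxE => <-.
by apply: eq_bigr => k _; rewrite !mxE mulrC.
Qed.

(** * The generating polynomial through its cofactors *)

Section GeneratingPoly.
Variables (R : realType) (n : nat) (s : nat -> R[i]).

(** Row 0 is mere filler ([0.-1 = 0]): the cofactors taken along it never read its entries. *)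
Let coef_mx : 'M[R[i]]_n.+1 := \matrix_(i, j) s (i.-1 + j)%N.
Let c (j : 'I_n.+1) := cofactor coef_mx ord0 j.

Lemma generating_polyE : generating_poly n s = \sum_j c j *: 'X^j.
Proof.
rewrite /generating_poly (expand_det_row _ ord0); apply: eq_bigr => j _.
rewrite mxE /= mulrC -mul_polyC; congr (_ * _).
rewrite /c /cofactor rmorphM rmorphXn rmorphN1; congr (_ * _).
rewrite -det_map_mx; congr (\det _).
by apply/matrixP => i k; rewrite !mxE.
Qed.

Lemma generating_poly_coef (j : 'I_n.+1) : (generating_poly n s)`_j = c j.
Proof.
rewrite generating_polyE coef_sum (bigD1 j) //= coefZ coefXn eqxx mulr1.
rewrite big1 ?addr0 // => k kj; rewrite coefZ coefXn.
by rewrite val_eqE eq_sym (negbTE kj) mulr0.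
Qed.

(** Row [i.+1] paired with the cofactors of row 0 is an off-diagonal entry of
    [coef_mx *m \adj coef_mx], a scalar matrix. *)
Lemma generating_poly_orthogonal i : (i < n)%N ->
  \sum_(j < n.+1) s (i + j)%N * (generating_poly n s)`_j = 0.
Proof.
move=> lt_in; have lt_i1 : (i.+1 < n.+1)%N by [].
have := mul_mx_adj coef_mx => /matrixP/(_ (Ordinal lt_i1) ord0).
rewrite !mxE /= mulr0n => adj0.
by rewrite -[RHS]adj0; apply: eq_bigr => j _; rewrite generating_poly_coef !mxE.
Qed.

Lemma generating_poly_hankel : size (generating_poly n s) = n.+1 ->
  \matrix_(i < n, j < n) s (i + j)%N \in unitmx.
Proof.
move=> /coef_pred_size_neq0.
rewrite -[n in _`_n]/(val (@ord_max n)) generating_poly_coef /c /cofactor.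
rewrite mulf_eq0 negb_or unitmxE unitfE => /andP[_].
(* Deleting row 0 turns the index [i.-1] back into [i]; deleting the last column leaves [j]
   unchanged. *)
congr (\det _ != 0); apply/matrixP => i j; rewrite !mxE /=.
by rewrite /bump leqNgt ltn_ord.
Qed.

End GeneratingPoly.

(** * Solutions of the moment system and roots of [G] *)

Section Moments.
Variables (R : realType) (n : nat) (s : nat -> R[i]).
Let G := generating_poly n s.
Hypothesis szG : size G = n.+1.

Lemma moment_solution_of_roots (mu lam : 'I_n -> R[i]) :
    (forall k, root G (lam k)) ->
    (forall m, (m < n)%N -> \sum_k mu k * lam k ^+ m = s m) ->
  moment_solution s mu lam.
Proof.
move=> Grt mu_s; elim/ltn_ind=> m IHm lt_m2n.
have [/mu_s//|le_nm] := ltnP m n.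
have G0 : G`_n != 0 := coef_pred_size_neq0 szG.
pose i := (m - n)%N; have lt_in : (i < n)%N by rewrite /i; lia.
have mE : m = (i + n)%N by rewrite subnK.
pose t p := \sum_k mu k * lam k ^+ p.
have tG : \sum_(j < n.+1) t (i + j)%N * G`_j = 0.
  under eq_bigr do rewrite mulr_suml.
  rewrite exchange_big big1 //= => k _.
  transitivity (mu k * lam k ^+ i * G.[lam k]); last first.
    by rewrite (rootP (Grt k)) mulr0.
  rewrite horner_coef szG mulr_sumr; apply: eq_bigr => j _.
  by rewrite exprD; ring.
(* [s] and [t] obey the same recurrence and agree below [m]; cancelling the nonzero leading
   coefficient gives agreement at [m]. *)
have := generating_poly_orthogonal s lt_in; rewrite -[RHS]tG !big_ord_recr /=.
rewrite -/G -mE -/(t m) => /eqP.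
rewrite (eq_bigr (fun j : 'I_n => t (i + j)%N * G`_j)) => [|j _].
  by rewrite (inj_eq (addrI _)) (inj_eq (mulIf G0)) => /eqP.
by rewrite /t IHm //; have := ltn_ord j; lia.
Qed.

Lemma moment_solution_roots (mu lam : 'I_n -> R[i]) :
  moment_solution s mu lam -> injective lam /\ forall k, root G (lam k).
Proof.
move=> mom.
pose A : 'M[R[i]]_n := \matrix_(i, k) (mu k * lam k ^+ i).
pose B : 'M[R[i]]_n := \matrix_(k, j) lam k ^+ j.
have := generating_poly_hankel szG.
rewrite (_ : \matrix_(_, _) _ = A *m B) => [|]; last first.
  apply/matrixP => i j; rewrite !mxE -mom; last first.
    by have := ltn_ord i; have := ltn_ord j; lia.
  by apply: eq_bigr => k _; rewrite !mxE exprD mulrA.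
rewrite unitmx_mul => /andP[Au]; rewrite unitmxE unitfE => detB; split.
  move=> k l lam_kl; apply/eqP; apply: contraNT detB => neq_kl; apply/eqP.
  by apply: (determinant_alternate neq_kl) => j; rewrite !mxE lam_kl.
move=> k; apply/rootP; suff: \col_k G.[lam k] = 0.
  by move=> /matrixP/(_ k 0); rewrite !mxE.
rewrite -[LHS](mulKmx Au) -[RHS](mulmx0 _ (invmx A)); congr (_ *m _).
apply/matrixP => i j; rewrite !mxE -[RHS](generating_poly_orthogonal s (ltn_ord i)).
under eq_bigr do rewrite !mxE horner_coef szG mulr_sumr.
(* Here [l] may equal [n], so the indices reach [2n-1], the last prescribed moment. *)
rewrite exchange_big /=; apply: eq_bigr => l _; rewrite -mom; last first.
  by have := ltn_ord i; have := ltn_ord l; lia.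
by rewrite mulr_suml; apply: eq_bigr => p _; rewrite exprD; ring.
Qed.

End Moments.

(** * Power series near 0 *)

Lemma sum_half_le2 (K : numFieldType) (N : nat) :
  \sum_(m < N) (2^-1 : K) ^+ m <= 2.
Proof.
suff -> : \sum_(m < N) (2^-1 : K) ^+ m = 2 - 2 * 2^-1 ^+ N.
  by rewrite gerBl mulr_ge0 // exprn_ge0 // invr_ge0.
elim: N => [|N IHN]; first by rewrite big_ord0 expr0 mulr1 subrr.
by rewrite big_ord_recr /= IHN exprS; field.
Qed.

(** The terms are bounded at some radius [r] of convergence, so for [|z| < r/2] a geometric series
    of ratio 1/2 dominates; starting at index [N] it yields the factor [|z|^N]. *)
Lemma pseries_bigO (K : numFieldType) (g : K -> K) (d : nat -> K) (N : nat) :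
    (forall m, (m < N)%N -> d m = 0) ->
    (\forall z \near (0 : K), [series d m * z ^+ m]_m @ \oo --> g z) ->
  exists2 k : K, 0 < k & \forall z \near (0 : K), `|g z| <= k * `|z ^+ N|.
Proof.
move=> d0 /nbhs_normP[e /= e_gt0 ge].
have half_lt (x : K) : 0 < x -> x / 2 < x.
  by move=> x_gt0; rewrite ltr_pdivrMr // ltr_pMr // ltr1n.
have [r r_gt0 r_lt_e] : exists2 r, 0 < r & r < e.
  by exists (e / 2); [rewrite divr_gt0|exact: half_lt].
have rE : `|r| = r by rewrite gtr0_norm.
have /ge gr : `|0 - r| < e by rewrite sub0r normrN rE.
have /cvg_seq_bounded : cvgn (fun m => d m * r ^+ m).
  by apply/cvg_ex; exists 0; apply: cvg_series_cvg_0; apply/cvg_ex; exists (g r).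
move=> /pinfty_ex_gt0[C C_gt0 dC].
(* Times [|z|^N] this is [2 * C * t^N] for the [t] below; the factor 2 bounds the geometric sum. *)
exists (2 * C * (2 / r) ^+ N); first by rewrite !mulr_gt0 // exprn_gt0 // divr_gt0.
apply/nbhs_normP; exists (r / 2) => [/=|z /=]; first by rewrite divr_gt0.
rewrite sub0r normrN => zr.
have gz : [series d m * z ^+ m]_m @ \oo --> g z.
  apply: ge; rewrite /= sub0r normrN; apply: lt_trans zr _.
  exact: lt_trans (half_lt _ r_gt0) r_lt_e.
pose t := 2 * `|z| / r.
have t_ge0 : 0 <= t by rewrite divr_ge0 ?mulr_ge0 // ltW.
have t_le1 : t <= 1 by rewrite ler_pdivrMr // mul1r mulrC -ler_pdivlMr // ltW.
(* t <= 1, so |d_m z^m| <= C (t/2)^m <= C t^N 2^-m for m >= N. *)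
have dz m : `|d m * z ^+ m| <= C * t ^+ N * 2^-1 ^+ m.
  have [/d0->|le_Nm] := ltnP m N.
    by rewrite mul0r normr0 !mulr_ge0 ?exprn_ge0 ?invr_ge0 // ltW.
  have -> : z = r * (z / r) by rewrite mulrCA divff ?mulr1 // gt_eqF.
  rewrite exprMn mulrA normrM normrX normf_div rE.
  have -> : `|z| / r = t * 2^-1 by rewrite /t; field; rewrite gt_eqF.
  rewrite [(t * _) ^+ m]exprMn mulrA ler_wpM2r ?exprn_ge0 ?invr_ge0 //.
  apply: ler_pM => //; first exact: exprn_ge0; first exact: dC.
  exact: ler_wiXn2l.
have Sz M : `|[series d m * z ^+ m]_m M| <= 2 * C * (2 / r) ^+ N * `|z ^+ N|.
  rewrite seriesEord /=; apply: le_trans (ler_norm_sum _ _ _) _.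
  apply: (@le_trans _ _ (\sum_(m < M) C * t ^+ N * 2^-1 ^+ m)).
    by apply: ler_sum => m _; exact: dz.
  have -> : 2 * C * (2 / r) ^+ N * `|z ^+ N| = C * t ^+ N * 2.
    by rewrite normrX /t [_ * `|z| / r]mulrAC [(_ * `|z|) ^+ N]exprMn; ring.
  rewrite -mulr_sumr ler_wpM2l ?sum_half_le2 //.
  by rewrite mulr_ge0 ?exprn_ge0 // ltW.
(* The bound passes to the limit: some partial sum is within [eps] of [g z]. *)
apply/ler_addgt0Pr => eps eps_gt0.
have /cvgrPdist_le/(_ _ eps_gt0)[M _ /(_ M (leqnn M)) /= gM] := gz.
rewrite -[g z](subrK ([series d m * z ^+ m]_m M)) addrC.
by apply: le_trans (ler_normD _ _) _; rewrite lerD.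
Qed.

Lemma pseriesB (K : numFieldType) (f g : K -> K) (a b : nat -> K) :
    (\forall z \near (0 : K), [series a m * z ^+ m]_m @ \oo --> f z) ->
    (\forall z \near (0 : K), [series b m * z ^+ m]_m @ \oo --> g z) ->
  \forall z \near (0 : K),
    [series (a m - b m) * z ^+ m]_m @ \oo --> f z - g z.
Proof.
move=> fa gb; near=> z.
have -> : [series (a m - b m) * z ^+ m]_m =
    (fun M => [series a m * z ^+ m]_m M - [series b m * z ^+ m]_m M).
  apply/funext => M; rewrite /= !seriesEord /= -sumrB.
  by apply: eq_bigr => m _; rewrite mulrBl.
by apply: cvgB; near: z.
Unshelve. all: by end_near.
Qed.

Lemma pseries_lin_comb (K : numFieldType) (n : nat) (mu lam : 'I_n -> K)
    (h : K -> K) (b : nat -> K) :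
    (\forall z \near (0 : K), [series b m * z ^+ m]_m @ \oo --> h z) ->
  \forall z \near (0 : K),
    [series b m * (\sum_k mu k * lam k ^+ m) * z ^+ m]_m @ \oo
      --> \sum_k mu k * h (lam k * z).
Proof.
move=> hb.
pose P (k : 'I_n) (z : K) :=
  [series b m * (lam k * z) ^+ m]_m @ \oo --> h (lam k * z).
have hP : \forall z \near (0 : K), forall k, P k z.
  (* Each dilation by [lam k] is continuous and fixes 0, and there are finitely many of them. *)
  apply: (filter_forall (F := nbhs (0 : K))) => k.
  have lam_cvg : lam k * z @[z --> (0 : K)] --> lam k * 0.
    exact: mulrl_continuous.
  by rewrite mulr0 in lam_cvg; exact: (lam_cvg _ hb).
apply: filterS hP => z hz.
have -> : [series b m * (\sum_k mu k * lam k ^+ m) * z ^+ m]_m =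
    (fun M => \sum_k mu k * [series b m * (lam k * z) ^+ m]_m M).
  apply/funext => M; rewrite seriesEord /=.
  under [RHS]eq_bigr do rewrite seriesEord /= mulr_sumr.
  rewrite exchange_big /=; apply: eq_bigr => m _.
  rewrite mulrAC mulr_sumr; apply: eq_bigr => k _.
  by rewrite exprMn; ring.
apply: cvg_big => [|k _]; first exact: add_continuous.
by apply: cvgMl_tmp; exact: hz.
Qed.

Lemma coef_ratioK (R : realType) (a b : nat -> R[i]) (m : nat) :
  (b m = 0 -> a m = 0) -> b m * coef_ratio a b m = a m.
Proof.
move=> ab; rewrite /coef_ratio; case: eqP => [->|a0]; first by rewrite mulr0.
by rewrite mulrC divfK //; apply/eqP => /ab.
Qed.

Theorem theorem1 (R : realType) (n : nat) (f h : R[i] -> R[i])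
    (f_ h_ : nat -> R[i])
    (hf : analytic_at0 f f_) (hh : analytic_at0 h h_)
    (hfh : forall m : nat, h_ m = 0 -> f_ m = 0)
    (hdeg : size (generating_poly n (coef_ratio f_ h_)) = n.+1)
    (hroots : distinct_roots (generating_poly n (coef_ratio f_ h_))) :
  exists mu lam : 'I_n -> R[i],
    [/\ moment_solution (coef_ratio f_ h_) mu lam,
        (forall mu' lam' : 'I_n -> R[i],
           moment_solution (coef_ratio f_ h_) mu' lam' ->
           exists sigma : 'S_n,
             forall k : 'I_n, mu' k = mu (sigma k) /\ lam' k = lam (sigma k))
      & f = amp_freq_op mu lam h +O_ (0 : R[i]) (fun z : R[i] => z ^+ (2 * n))].
Proof.
set s := coef_ratio f_ h_ in hdeg hroots *.
set G := generating_poly n s in hdeg hroots.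
have [rs GE rs_uniq] := hroots.
have lcG : lead_coef G != 0 by rewrite lead_coef_eq0 -size_poly_eq0 hdeg.
have sz_rs : size rs = n.
  by move: hdeg; rewrite GE size_scale // size_prod_XsubC => -[].
have root_rs x : root G x = (x \in rs).
  by rewrite GE rootZ // root_prod_XsubC.
pose lam (k : 'I_n) := rs`_k.
have lam_inj : injective lam.
  by move=> k l /eqP; rewrite nth_uniq ?sz_rs // => /eqP/val_inj.
have lam_root k : root G (lam k) by rewrite root_rs mem_nth ?sz_rs.
have [mu mu_s] := moments_surjective s lam_inj.
have mom := moment_solution_of_roots hdeg lam_root mu_s.
exists mu, lam; split=> // [mu' lam' mom'|].
  have [lam'_inj lam'_root] := moment_solution_roots hdeg mom'.
  have idx_lt k : (index (lam' k) rs < n)%N.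
    by rewrite -[X in (_ < X)%N]sz_rs index_mem -root_rs.
  (* [sig k] is the position in [rs] of the root [lam' k]. *)
  pose sig k := Ordinal (idx_lt k).
  have lam_sig k : lam (sig k) = lam' k by rewrite /lam /= nth_index // -root_rs.
  have sig_inj : injective sig.
    by move=> k l /(congr1 lam); rewrite !lam_sig => /lam'_inj.
  exists (perm sig_inj) => k; rewrite permE lam_sig; split=> //.
  (* Both weight families solve the same Vandermonde system at the nodes [lam']. *)
  apply: (moments_injective lam'_inj (d := mu \o sig)) => m lt_mn.
  rewrite mom'; last by lia.
  rewrite -mu_s // (reindex_inj sig_inj) /=.
  by under eq_bigr do rewrite lam_sig.
apply/eqaddOP/bigO_exP.
(* Below [2n] the moment equations turn the subtracted term into [h_ m * s m = f_ m]. *)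
apply: (@pseries_bigO _ _ (fun m => f_ m - h_ m * \sum_k mu k * lam k ^+ m)).
  by move=> m /mom ->; rewrite coef_ratioK ?subrr //; apply: hfh.
exact: pseriesB hf (pseries_lin_comb mu lam hh).
Qed.
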